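(* Let $k=k(n)$ be positive integers with $k=o(n^{1/4})$. Then no one-round $\mathsf{BCAST}(1)$ protocol can distinguish between $\mathcal{A}^n_{\mathsf{rand}}$ and $\mathcal{A}^n_k$ with advantage $\Omega(1)$; that is, for every sequence $(\Pi_n)$ of one-round $n$-processor $\mathsf{BCAST}(1)$ protocols, if $\Pi_n$ accepts an input drawn from $\mathcal{A}^n_{\mathsf{rand}}$ with probability $p_n$, then it accepts an input drawn from $\mathcal{A}^n_k$ with probability $p_n\pm o(1)$ as $n\to\infty$.
   Context: **Model.** In the $\mathsf{BCAST}(1)$ (Broadcast Congested Clique) model there are $n$ processors numbered $1,\dots,n$, each holding a private input string and having unlimited computational power. Computation proceeds in synchronous rounds; in each round every processor broadcasts a single bit (the same bit to all processors), which may depend on its index, its input, its random bits (independent of the inputs) and all bits broadcast in previous rounds. The transcript is the list of all broadcast bits, together with sender and round. Whether a protocol accepts is determined by its transcript. When the input is a matrix $A\in\{0,1\}^{n\times n}$, processor $i$ receives the $i$-th row of $A$. **Distributions.** $\mathcal{A}^n_{\mathsf{rand}}$ is the distribution of $A\in\{0,1\}^{n\times n}$ with $A_{i,i}=0$ for all $i$ and with $A_{i,j}$ ($i\neq j$) independent uniform bits. For $C\subseteq[n]$, $\mathcal{A}^n_C$ is $\mathcal{A}^n_{\mathsf{rand}}$ conditioned on $A_{i,j}=1$ for all $i,j\in C$, $i\ne j$. $\mathcal{A}^n_k$ is the mixture of the $\mathcal{A}^n_C$ over a uniformly random $C\subseteq[n]$ with $|C|=k$. *)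

(* Defs.v *)
From HB Require Import structures.
From mathcomp Require Import all_boot all_order all_algebra.
From mathcomp Require Import all_classical all_reals all_analysis.

Set Implicit Arguments.
Unset Strict Implicit.
Unset Printing Implicit Defensive.

Import Order.TTheory GRing.Theory Num.Theory.
Import numFieldNormedType.Exports.

Local Open Scope classical_set_scope.
Local Open Scope ring_scope.

(* Each of the n processors owns an infinite tape of private random bits:
   [coin i j] is the j-th bit of processor i.  [coins_iid] gives the law of every
   finite block of bits, i.e. all the bits together are independent and fair. *)
Record coins (R : realType) (n : nat) := Coins {
  coins_display : measure_display ;
  coins_space : measurableType coins_display ;
  coins_prob : probability coins_space R ;
  coin : 'I_n -> nat -> coins_space -> bool ;
  measurable_coin : forall i j, measurable_fun [set: coins_space] (coin i j) ;
  coins_iid : forall (m : nat) (b : 'I_n -> 'I_m -> bool),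
    coins_prob [set w | forall (i : 'I_n) (j : 'I_m), coin i j w = b i j]
      = ((2^-1) ^+ (n * m))%:E
}.

(* The bits broadcast in one round, indexed by sender. *)
Definition round_bits (n : nat) := {ffun 'I_n -> bool}.

(* An r-round BCAST(1) protocol for n processors with inputs in X.  Histories
   and transcripts list the rounds in chronological order. *)
Record protocol (R : realType) (X : Type) (n r : nat) := Protocol {
  randomness : coins R n ;
  message : 'I_n -> X -> (nat -> bool) -> seq (round_bits n) -> bool ;
  measurable_message : forall (i : 'I_n) (x : X) (h : seq (round_bits n)),
    measurable_fun [set: coins_space randomness]
      (fun w => message i x (fun j => @coin _ _ randomness i j w) h) ;
  accepting : seq (round_bits n) -> bool
}.

Fixpoint history (R : realType) (X : Type) (n r : nat) (Pi : protocol R X n r)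
    (x : 'I_n -> X) (w : coins_space (randomness Pi)) (t : nat)
    : seq (round_bits n) :=
  if t is t'.+1 then
    let h := history x w t' in
    rcons h [ffun i => message Pi i (x i)
                         (fun j => @coin _ _ (randomness Pi) i j w) h]
  else [::].

Definition transcript (R : realType) (X : Type) (n r : nat)
    (Pi : protocol R X n r) (x : 'I_n -> X) (w : coins_space (randomness Pi))
    : seq (round_bits n) :=
  history x w r.

(* Processor i receives row i of the input matrix. *)
Definition matrix_protocol (R : realType) (n r : nat) :=
  protocol R 'rV[bool]_n n r.

(* The input A is drawn from the mass function D, independently of the coins. *)
Definition accept_prob (R : realType) (n r : nat) (Pi : matrix_protocol R n r)
    (D : 'M[bool]_n -> R) : R :=
  \sum_(A : 'M[bool]_n)
    D A * fine (coins_prob (randomness Pi)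
                  [set w | accepting Pi (transcript (fun i => row i A) w)]).

Definition A_rand (R : realType) (n : nat) (A : 'M[bool]_n) : R :=
  \prod_(i < n) \prod_(j < n) (if i == j then (A i j == false)%:R else 2^-1).

Definition conditioned (R : realType) (T : finType) (D : T -> R) (E : pred T)
    (a : T) : R :=
  (if E a then D a else 0) / \sum_(b | E b) D b.

Definition is_clique (n : nat) (C : {set 'I_n}) (A : 'M[bool]_n) : bool :=
  [forall i in C, forall j in C, (i != j) ==> A i j].

Definition A_planted (R : realType) (n : nat) (C : {set 'I_n})
    : 'M[bool]_n -> R :=
  conditioned (@A_rand R n) (is_clique C).

(* Only meaningful for k <= n; identically 0 when k > n. *)
Definition A_clique (R : realType) (n k : nat) (A : 'M[bool]_n) : R :=
  (\sum_(C : {set 'I_n} | #|C| == k) A_planted R C A)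
    / #|[set C : {set 'I_n} | #|C| == k]|%:R.

(* Main.v *)
(* After fixing the random bits, the i-th bit broadcast is f_i(row i), so the n
   bits are independent under both A_rand and A_C, and only the senders i in C
   see a different row law.  The l1-distance of the two transcript laws is thus
   at most 2 sum_{i in C} |E[f_i | S] - E[f_i]|, where S = C minus i and S also
   denotes the event that the entries of the row indexed by S are all 1.

   Let chi_j = +1 or -1 encode the j-th entry.  Then
   E[f | S + j] - E[f | S] = E[f chi_j | S], and the chi_j with j outside S are
   orthonormal for the law conditioned on S; hence the sum over the M = n-1-|S|
   possible j of |E[f | S + j] - E[f | S]| is at most sqrt M.  Adding the
   elements of a random S one at a time bounds the average over |S| = k-1 of
   |E[f | S] - E[f]| by (k-1) / sqrt (n-k).  The advantage is therefore at most
   2 k^2 / sqrt (n-k), which tends to 0 when k = o(n^(1/4)). *)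

Require Import Defs.
From HB Require Import structures.
From mathcomp Require Import all_boot all_order all_algebra.
From mathcomp Require Import all_classical all_reals all_analysis.
From mathcomp Require Import ring lra zify.

Set Implicit Arguments.
Unset Strict Implicit.
Unset Printing Implicit Defensive.

Import Order.TTheory GRing.Theory Num.Theory.
Import numFieldNormedType.Exports.

Local Open Scope ring_scope.

(** * Sums and distances on product spaces *)

Lemma sum_matrix_prod_row (R : comPzSemiRingType) (n : nat)
    (G : 'I_n -> 'rV[bool]_n -> R) :
  \sum_(A : 'M[bool]_n) \prod_i G i (row i A) = \prod_i \sum_r G i r.
Proof.
rewrite bigA_distr_bigA /=.
rewrite (reindex (fun A : 'M[bool]_n => [ffun i => row i A])) /=; last first.
  exists (fun F : {ffun 'I_n -> 'rV[bool]_n} => \matrix_i F i).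
    move=> A _; apply/row_matrixP => i; rewrite rowK ffunE //.
  by move=> F _; apply/ffunP => i; rewrite ffunE rowK.
by apply: eq_bigr => A _; apply: eq_bigr => i _; rewrite ffunE.
Qed.

Lemma sum_rV_prod (R : comPzSemiRingType) (n : nat) (q : 'I_n -> bool -> R) :
  \sum_(r : 'rV[bool]_n) \prod_j q j (r ord0 j) = \prod_j \sum_b q j b.
Proof.
rewrite bigA_distr_bigA /=.
rewrite (reindex (fun r : 'rV[bool]_n => [ffun j => r ord0 j])) /=; last first.
  exists (fun F : {ffun 'I_n -> bool} => \row_j F j).
    by move=> r _; apply/rowP => j; rewrite mxE ffunE.
  by move=> F _; apply/ffunP => j; rewrite ffunE mxE.
by apply: eq_bigr => A _; apply: eq_bigr => i _; rewrite ffunE.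
Qed.

(** Double counting: removing [j] from [C] matches the pairs with [j] in [C] to the pairs with [j]
    outside [S]. It serves both to grow a random set by one element and to average over the planted
    clique. *)
Lemma sum_card_succ_setD1 (R : nmodType) (T : finType) (s : nat)
    (H : T -> {set T} -> R) :
  \sum_(C : {set T} | #|C| == s.+1) \sum_(j in C) H j (C :\ j)%SET
    = \sum_j \sum_(S : {set T} | (#|S| == s) && (j \notin S)) H j S.
Proof.
rewrite (exchange_big_dep xpredT) //=; apply: eq_bigr => j _.
rewrite (reindex_onto (fun S => j |: S)%SET (fun C => C :\ j)%SET) /=; last first.
  by move=> C /andP[_ jC]; rewrite finset.setD1K.
have jS S : ((j |: S) :\ j == S)%SET = (j \notin S).
  apply/eqP/idP => [<-|/setU1K //]; by rewrite setD11.
apply: eq_big => [S|S /andP[_ /eqP-> //]].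
rewrite jS setU11 andbT; case: (boolP (j \in S)) => /= jNS; rewrite ?andbF ?andbT //.
by rewrite cardsU1 jNS eqSS.
Qed.

Lemma l1_dist_prod_le (R : realType) (I : finType) (p q : I -> bool -> R)
    (p0 : forall i b, 0 <= p i b) (q0 : forall i b, 0 <= q i b)
    (p1 : forall i, \sum_b p i b = 1) (q1 : forall i, \sum_b q i b = 1) :
  \sum_(b : {ffun I -> bool}) `|\prod_i p i (b i) - \prod_i q i (b i)|
    <= \sum_i \sum_b `|p i b - q i b|.
Proof.
(* Hybrid argument: [h s] has the coordinates in [s] switched from [p] to [q]. *)
pose h (s : seq I) i := if i \in s then q i else p i.
have hyb (s : seq I) : uniq s ->
    \sum_(b : {ffun I -> bool}) `|\prod_i p i (b i) - \prod_i h s i (b i)|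
      <= \sum_(i <- s) \sum_b `|p i b - q i b|.
  elim: s => [_|i s IH /= /andP[iNs us]].
    by rewrite big_nil big1 // => b _; rewrite /h subrr normr0.
  rewrite big_cons.
  (* Consecutive hybrids differ only in factor [i]. The other factors have total mass 1, so summing
     over [b] leaves the distance at [i] alone. *)
  pose G j (c : bool) := if j == i then `|p i c - q i c| else h s j c.
  have -> : \sum_b `|p i b - q i b| = \sum_(b : {ffun I -> bool}) \prod_j G j (b j).
    rewrite -(bigA_distr_bigA G) (bigD1 i) //= [X in _ * X]big1 /G ?eqxx ?mulr1 // => j jNi.
    by rewrite (negbTE jNi) /h; case: ifP.
  apply: le_trans (lerD (lexx _) (IH us)); rewrite addrC -big_split /=.
  apply: ler_sum => b _.
  apply: le_trans (ler_distD (\prod_j h s j (b j)) _ _) _.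
  rewrite lerD2l (bigD1 i) //= [X in _ - X](bigD1 i) //= [leRHS](bigD1 i) //=.
  have -> : \prod_(j | j != i) h (i :: s) j (b j) = \prod_(j | j != i) h s j (b j).
    by apply: eq_bigr => j jNi; rewrite /h inE (negbTE jNi).
  rewrite -mulrBl normrM {1}/h (negbTE iNs) {1}/h inE eqxx /= /G eqxx.
  rewrite ler_wpM2l // ger0_norm; last first.
    by apply: prodr_ge0 => j _; rewrite /h; case: ifP.
  by rewrite le_eqVlt; apply/orP; left; apply/eqP; apply: eq_bigr => j /negbTE->.
have := hyb (index_enum I) (index_enum_uniq I).
congr (_ <= _); apply: eq_bigr => b _; congr (`|_ - _|).
by apply: eq_bigr => i _; rewrite /h mem_index_enum.
Qed.

(** * The law of one row and its sign characters *)

Section RowMass.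
Variables (R : realType) (n : nat) (i : 'I_n).
Implicit Types (T : {set 'I_n}) (j l : 'I_n) (r : 'rV[bool]_n).

(** Single-entry law in row [i], with the entries in [T] forced to 1. The diagonal case is tested
    first, so this is a probability mass even when [i] lies in [T]. *)
Definition entry_mass (T : {set 'I_n}) (j : 'I_n) (b : bool) : R :=
  if i == j then (b == false)%:R else if j \in T then b%:R else 2^-1.

Definition row_mass (T : {set 'I_n}) (r : 'rV[bool]_n) : R :=
  \prod_j entry_mass T j (r ord0 j).

Definition row_mean (f : 'rV[bool]_n -> bool) (T : {set 'I_n}) : R :=
  \sum_r row_mass T r * (f r)%:R.

Lemma row_mass_ge0 T r : 0 <= row_mass T r.
Proof.
apply: prodr_ge0 => j _; rewrite /entry_mass.
by do 2?case: ifP => _; rewrite ?ler0n // invr_ge0 ler0n.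
Qed.

Lemma sum_row_mass T : \sum_r row_mass T r = 1.
Proof.
rewrite sum_rV_prod big1 // => j _; rewrite big_bool /entry_mass /=.
by do 2?case: ifP => _; rewrite ?add0r ?addr0 // -mulr2n -[_ *+ 2]mulr_natr mulVf ?pnatr_eq0.
Qed.

Definition sgn_entry (r : 'rV[bool]_n) (j : 'I_n) : R := (r ord0 j)%:R *+ 2 - 1.

Lemma sgn_entry_sqr r j : sgn_entry r j * sgn_entry r j = 1.
Proof. by rewrite /sgn_entry; case: (r _ _); rewrite /=; ring. Qed.

(* Correlations with the signs thus become differences of means; applied to total
   masses, which are all 1, this gives the orthogonality of the signs. *)
Lemma row_mass_sgn T j r : j != i -> j \notin T ->
  row_mass T r * sgn_entry r j = row_mass (j |: T)%SET r - row_mass T r.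
Proof.
move=> ji jT; rewrite /row_mass (bigD1 j) //=.
rewrite [X in _ = X - _](bigD1 j) //=.
have -> : \prod_(l | l != j) entry_mass (j |: T)%SET l (r ord0 l)
  = \prod_(l | l != j) entry_mass T l (r ord0 l).
  by apply: eq_bigr => l lj; rewrite /entry_mass !inE (negbTE lj).
rewrite /entry_mass eq_sym (negbTE ji) (negbTE jT) setU11 /sgn_entry.
by field.
Qed.

Lemma sgn_entry_orthonormal T j l : j != i -> j \notin T -> l != i -> l \notin T ->
  \sum_r row_mass T r * (sgn_entry r j * sgn_entry r l) = (j == l)%:R.
Proof.
move=> ji jT li lT; have [<-|jl] := eqVneq j l.
  by under eq_bigr => r _ do rewrite sgn_entry_sqr mulr1; rewrite sum_row_mass.
transitivity (\sum_r ((row_mass (l |: (j |: T))%SET r - row_mass (j |: T)%SET r)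
                     - (row_mass (l |: T)%SET r - row_mass T r))).
  apply: eq_bigr => r _; rewrite mulrA row_mass_sgn // mulrBl !row_mass_sgn //.
  by rewrite !inE (negbTE lT) eq_sym (negbTE jl).
by rewrite !sumrB !sum_row_mass !subrr.
Qed.

Lemma row_mean_setU1B f T j : j != i -> j \notin T ->
  row_mean f (j |: T)%SET - row_mean f T
    = \sum_r row_mass T r * (sgn_entry r j * (f r)%:R).
Proof.
move=> ji jT; rewrite /row_mean -sumrB; apply: eq_bigr => r _.
by rewrite mulrA row_mass_sgn // mulrBl.
Qed.

(** The differences are the correlations of [f] with orthonormal signs, so this is a Bessel-type
    bound in l1 form; [d] is the square root of the number of signs. *)
Lemma sum_row_mean_setU1B f (T : {set 'I_n}) (d : R) : 0 < d ->
  #|[set j | (j \notin T) && (j != i)]%SET|%:R = d ^+ 2 ->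
  \sum_(j | (j \notin T) && (j != i)) `|row_mean f (j |: T)%SET - row_mean f T| <= d.
Proof.
move=> d0 cardJ; pose P j := (j \notin T) && (j != i).
pose a j := row_mean f (j |: T)%SET - row_mean f T.
(* Weighting each character by the sign of its correlation turns the sum of absolute values into the
   single correlation of [f] with [u]. *)
pose u r := \sum_(j | P j) Num.sg (a j) * sgn_entry r j.
have -> : \sum_(j | P j) `|a j| = \sum_r row_mass T r * (u r * (f r)%:R).
  rewrite /u; under [RHS]eq_bigr => r _ do rewrite mulr_suml mulr_sumr.
  rewrite exchange_big /=; apply: eq_bigr => j /andP[jT ji].
  rewrite normrEsg {2}/a row_mean_setU1B // mulr_sumr.
  by apply: eq_bigr => r _; ring.
(* By orthonormality the second moment of [u] is the sum of its squared coefficients, each at most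
   1. *)
have u2 : \sum_r row_mass T r * u r ^+ 2 <= d ^+ 2.
  have -> : \sum_r row_mass T r * u r ^+ 2 = \sum_(j | P j) Num.sg (a j) ^+ 2.
    transitivity (\sum_(j | P j) \sum_(l | P l) Num.sg (a j) * Num.sg (a l)
      * \sum_r row_mass T r * (sgn_entry r j * sgn_entry r l)).
      under [RHS]eq_bigr => j _ do under eq_bigr => l _ do rewrite mulr_sumr.
      under [RHS]eq_bigr => j _ do rewrite exchange_big.
      rewrite [RHS]exchange_big /=; apply: eq_bigr => r _.
      rewrite expr2 {1}/u mulr_suml mulr_sumr; apply: eq_bigr => j _.
      rewrite /u !mulr_sumr; apply: eq_bigr => l _; ring.
    apply: eq_bigr => j Pj; have /andP[jT ji] := Pj.
    rewrite (bigD1 j) //= sgn_entry_orthonormal // eqxx mulr1 big1 ?addr0 //.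
    move=> l /andP[/andP[lT li] lj].
    by rewrite sgn_entry_orthonormal // eq_sym (negbTE lj) mulr0.
  rewrite -cardJ -sum1_card natr_sum big_mkcond [leRHS]big_mkcond /=.
  apply: ler_sum => j _; rewrite inE -/(P j); case: (P j) => //.
  by rewrite sqr_sg lern1 leq_b1.
(* AM-GM: [u f <= (u ^ 2 / d + d) / 2]. *)
apply: (@le_trans _ _ (\sum_r row_mass T r * ((u r ^+ 2 / d + d) / 2))).
  apply: ler_sum => r _; apply: ler_wpM2l; first exact: row_mass_ge0.
  have h : 0 <= (u r - d) ^+ 2 / d by rewrite divr_ge0 ?sqr_ge0 // ltW.
  have e : (u r - d) ^+ 2 / d = u r ^+ 2 / d - u r * 2 + d by field; rewrite gt_eqF.
  have h0 : 0 <= u r ^+ 2 / d by rewrite divr_ge0 ?sqr_ge0 // ltW.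
  rewrite {}e in h; case: (f r) => /=; lra.
have -> : \sum_r row_mass T r * ((u r ^+ 2 / d + d) / 2)
   = (\sum_r row_mass T r * u r ^+ 2) / d / 2 + (\sum_r row_mass T r) * (d / 2).
  rewrite !mulr_suml -big_split /=; apply: eq_bigr => r _.
  by field; rewrite gt_eqF.
have : (\sum_r row_mass T r * u r ^+ 2) / d <= d by rewrite ler_pdivrMr // -expr2.
rewrite sum_row_mass; lra.
Qed.

End RowMass.

(** * Average deviation over random conditioning sets *)

Lemma card_sets_avoiding (T : finType) (x : T) (s : nat) :
  #|[set S : {set T} | (#|S| == s) && (x \notin S)]%SET| = 'C(#|T|.-1, s).
Proof.
rewrite -(cardsC1 x) -cards_draws; apply: eq_card => S.
by rewrite !inE finset.subsetC finset.sub1set inE andbC.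
Qed.

(** Induction on [s]. There are ['C(n.-1, s)] sets, so the claim is an average deviation of at most
    s / sqrt (n - k): each added element costs at most 1 / sqrt (n - k) on average. *)
Lemma sum_row_mean_dev (R : realType) (n k s : nat) (i : 'I_n)
    (f : 'rV[bool]_n -> bool) : (k < n)%N -> (s < k)%N ->
  \sum_(S : {set 'I_n} | (#|S| == s) && (i \notin S))
      `|row_mean R i f S - row_mean R i f finset.set0|
    <= 'C(n.-1, s)%:R * s%:R / Num.sqrt (n - k)%:R.
Proof.
move=> kn; have dk0 : 0 < Num.sqrt (n - k)%:R :> R by rewrite sqrtr_gt0 ltr0n subn_gt0.
elim: s => [_|s IH sk].
  rewrite big1 ?mulr0 ?mul0r // => S /andP[/eqP/cards0_eq -> _].
  by rewrite subrr normr0.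
pose F := row_mean R i f; set m := n.-1.
(* The condition that [i] is avoided moves into the summand, since the double counting ranges over
   all sets of a given size. *)
pose H j (S : {set 'I_n}) :=
  if (j != i) && (i \notin S) then `|F (j |: S)%SET - F finset.set0| else 0.
have sm : (s < m)%N by rewrite /m; case: (n) kn sk => //=; lia.
pose e : R := Num.sqrt (m - s)%:R.
have e0 : 0 < e by rewrite sqrtr_gt0 ltr0n subn_gt0.
have cardJ (S : {set 'I_n}) : #|S| = s -> i \notin S ->
    #|[set j | (j \notin S) && (j != i)]%SET| = (m - s)%N.
  move=> cS iS; have -> : [set j | (j \notin S) && (j != i)]%SET = (~: (i |: S))%SET.
    by apply/finset.setP => j; rewrite !inE negb_or andbC.
  by rewrite cardsCs finset.setCK cardsU1 iS cS card_ord /m; case: (n) kn => //; lia.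
(* The factor [s.+1] counts the choices of the element added last. *)
rewrite -(@ler_pM2l _ s.+1%:R) ?ltr0n //.
have -> : s.+1%:R * (\sum_(S : {set 'I_n} | (#|S| == s.+1) && (i \notin S))
      `|F S - F finset.set0|) = \sum_(S : {set 'I_n} | (#|S| == s) && (i \notin S))
      \sum_(j | (j \notin S) && (j != i)) `|F (j |: S)%SET - F finset.set0|.
  transitivity (\sum_(C : {set 'I_n} | #|C| == s.+1) \sum_(j in C) H j (C :\ j)%SET).
    rewrite mulr_sumr big_mkcondr; apply: eq_bigr => C /eqP cC.
    case: (boolP (i \in C)) => iC /=.
      rewrite big1 // => j jC; rewrite /H !inE iC andbT.
      by have [->|ji] := eqVneq j i; rewrite // eq_sym ji.
    transitivity (\sum_(j in C) `|F C - F finset.set0|).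
      by rewrite sumr_const cC mulr_natl.
    apply: eq_bigr => j jC; rewrite /H !inE (negbTE iC) andbF andbT finset.setD1K //.
    by case: eqVneq => // ji; rewrite -ji jC in iC.
  rewrite sum_card_succ_setD1.
  rewrite (exchange_big_dep (fun S : {set 'I_n} => #|S| == s)) /=; last first.
    by move=> j S _ /andP[].
  rewrite [RHS]big_mkcondr; apply: eq_bigr => S cS.
  rewrite cS /H; case: (boolP (i \in S)) => iS /=.
    by rewrite big1 // => j _; rewrite andbF.
  by rewrite [RHS]big_mkcondr; apply: eq_bigr => j _; rewrite andbT.
have step : \sum_(S : {set 'I_n} | (#|S| == s) && (i \notin S))
      \sum_(j | (j \notin S) && (j != i)) `|F (j |: S)%SET - F finset.set0|
   <= \sum_(S : {set 'I_n} | (#|S| == s) && (i \notin S))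
       (e + (m - s)%:R * `|F S - F finset.set0|).
  apply: ler_sum => S /andP[/eqP cS iS].
  apply: (@le_trans _ _ (\sum_(j | (j \notin S) && (j != i))
     (`|F (j |: S)%SET - F S| + `|F S - F finset.set0|))).
    by apply: ler_sum => j _; apply: ler_distD.
  rewrite big_split /=; apply: lerD.
    by apply: sum_row_mean_setU1B; rewrite // cardJ // sqr_sqrtr ?ler0n.
  by rewrite -(cardJ S) // sumr_const mulr_natl cardsE.
apply: (le_trans step); rewrite big_split /= -mulr_sumr.
have -> : \sum_(S : {set 'I_n} | (#|S| == s) && (i \notin S)) e = 'C(m, s)%:R * e.
  by rewrite sumr_const -cardsE card_sets_avoiding card_ord mulr_natl.
(* Here [e] is [(m - s)%:R / e], and [n - k <= m - s] because [s.+1 <= k]. *)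
have em : e <= (m - s)%:R / Num.sqrt (n - k)%:R.
  rewrite ler_pdivlMr // -[leRHS](@sqr_sqrtr _ (m - s)%:R) ?ler0n // expr2 -/e.
  rewrite ler_pM2l // ler_sqrt ?ler0n // ler_nat /m; lia.
have -> : s.+1%:R * ('C(m, s.+1)%:R * s.+1%:R / Num.sqrt (n - k)%:R)
    = (m - s)%:R * 'C(m, s)%:R * (s%:R + 1) / Num.sqrt (n - k)%:R :> R.
  have binE : s.+1%:R * 'C(m, s.+1)%:R = (m - s)%:R * 'C(m, s)%:R :> R.
    by rewrite -!natrM mul_bin_left.
  by rewrite -binE natr1; ring.
have := IH (ltnW sk); rewrite -/F -/m => IHs.
have h1 : 'C(m, s)%:R * e <= 'C(m, s)%:R * ((m - s)%:R / Num.sqrt (n - k)%:R).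
  by rewrite ler_wpM2l ?ler0n.
have h2 := ler_wpM2l (ler0n R (m - s)) IHs.
apply: le_trans (lerD h1 h2) _; rewrite le_eqVlt; apply/orP; left; apply/eqP.
ring.
Qed.

(** * Deterministic one-round protocols *)

Lemma deterministic_protocol_dist (R : realType) (n : nat)
    (g : 'I_n -> 'rV[bool]_n -> bool) (acc : {ffun 'I_n -> bool} -> bool)
    (S : 'I_n -> {set 'I_n}) :
  `|\sum_(A : 'M[bool]_n) (\prod_i row_mass R i (S i) (row i A)
         - \prod_i row_mass R i finset.set0 (row i A)) * (acc [ffun i => g i (row i A)])%:R|
    <= 2 * \sum_i `|row_mean R i (g i) (S i) - row_mean R i (g i) finset.set0|.
Proof.
(* [p U i] is the law of the bit sent by [i]. Rows are independent, so the transcript law is the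
   product of these; [push] moves the sum from inputs to transcripts. *)
pose p (U : 'I_n -> {set 'I_n}) i b : R := \sum_r row_mass R i (U i) r * (g i r == b)%:R.
have push U : \sum_(A : 'M[bool]_n) \prod_i row_mass R i (U i) (row i A)
      * (acc [ffun i => g i (row i A)])%:R
    = \sum_(b : {ffun 'I_n -> bool}) (\prod_i p U i (b i)) * (acc b)%:R.
  under [RHS]eq_bigr => b _ do rewrite /p -sum_matrix_prod_row mulr_suml.
  rewrite exchange_big /=; apply: eq_bigr => A _.
  (* For a fixed input only the transcript it produces contributes. *)
  rewrite (bigD1 [ffun i => g i (row i A)]) //= [X in _ + X]big1 ?addr0.
    congr (_ * _); apply: eq_bigr => i _.
    by rewrite ffunE eqxx mulr1.
  move=> b bA; have [i bi] : exists i, g i (row i A) != b i.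
    apply/existsP; rewrite -negb_forall; apply: contra bA => /forallP h.
    by apply/eqP/ffunP => i; rewrite ffunE; apply/esym/eqP/h.
  by rewrite (bigD1 i) //= (negbTE bi) mulr0 !mul0r.
have p0 U i b : 0 <= p U i b.
  by apply: sumr_ge0 => r _; rewrite mulr_ge0 ?ler0n ?row_mass_ge0.
have ptrue U i : p U i true = row_mean R i (g i) (U i).
  by apply: eq_bigr => r _; rewrite eqb_id.
have p1 U i : \sum_b p U i b = 1.
  transitivity (\sum_r row_mass R i (U i) r); last exact: sum_row_mass.
  rewrite big_bool /p -big_split /=; apply: eq_bigr => r _.
  by rewrite -mulrDr; case: (g i r); rewrite /= ?addr0 ?add0r mulr1.
under eq_bigr => A _ do rewrite mulrBl.
rewrite sumrB (push S) (push (fun=> finset.set0)) -sumrB.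
apply: le_trans (ler_norm_sum _ _ _) _.
apply: le_trans (_ : _ <= \sum_(b : {ffun 'I_n -> bool})
   `|\prod_i p S i (b i) - \prod_i p (fun=> finset.set0) i (b i)|) _.
  apply: ler_sum => b _; rewrite -mulrBl normrM.
  by case: (acc b); rewrite ?normr1 ?normr0 ?mulr1 ?mulr0.
apply: le_trans (l1_dist_prod_le (p0 S) (p0 _) (p1 S) (p1 _)) _.
rewrite mulr_sumr; apply: ler_sum => i _.
(* Both values of a bit deviate by the same amount, whence the factor 2. *)
have pf U : p U i false = 1 - p U i true.
  by rewrite -(p1 U i) big_bool /= addrAC subrr add0r.
rewrite big_bool /= !pf !ptrue.
have -> : forall x y : R, 1 - x - (1 - y) = - (x - y) by move=> x y; ring.
by rewrite normrN mulr2n mulrDl mul1r.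
Qed.

Lemma A_rand_row_mass (R : realType) (n : nat) (A : 'M[bool]_n) :
  A_rand R A = \prod_i row_mass R i finset.set0 (row i A).
Proof.
apply: eq_bigr => i _; apply: eq_bigr => j _.
by rewrite /entry_mass finset.inE mxE.
Qed.

(** The entries of row [i] that the clique on [C] forces to 1; [i] itself is removed since the
    diagonal stays 0. *)
Definition planted_support (n : nat) (C : {set 'I_n}) (i : 'I_n) : {set 'I_n} :=
  if i \in C then (C :\ i)%SET else finset.set0.

Lemma A_planted_row_mass (R : realType) (n : nat) (C : {set 'I_n}) (A : 'M[bool]_n) :
  A_planted R C A = \prod_i row_mass R i (planted_support C i) (row i A).
Proof.
(* [c] is the probability of the clique event under [A_rand]. This is read off in [den] by summing
   the pointwise identity [num], as the row laws have mass 1. *)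
pose c : R := \prod_(i < n) \prod_(j < n)
  (if [&& i != j, i \in C & j \in C] then 2^-1 else 1).
have c0 : c != 0.
  apply/prodf_neq0 => i _; apply/prodf_neq0 => j _.
  by case: ifP => _; rewrite ?oner_neq0 ?invr_neq0 ?pnatr_eq0.
have num (B : 'M[bool]_n) : (if is_clique C B then A_rand R B else 0)
    = c * \prod_i row_mass R i (planted_support C i) (row i B).
  case: ifPn => [cB|].
    rewrite /A_rand /c -big_split; apply: eq_bigr => i _.
    rewrite -big_split; apply: eq_bigr => j _ /=.
    rewrite /entry_mass /planted_support mxE; case: eqVneq => [_|ij] /=.
      by rewrite mul1r.
    case: (boolP (i \in C)) => iC /=; last by rewrite finset.inE mul1r.
    rewrite !finset.inE (eq_sym j) ij /=; case: (boolP (j \in C)) => jC; last by rewrite mul1r.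
    move/forallP/(_ i)/implyP/(_ iC)/forallP/(_ j)/implyP/(_ jC): cB.
    by rewrite ij /= => ->; rewrite mulr1.
  rewrite negb_forall => /existsP[i]; rewrite negb_imply => /andP[iC].
  rewrite negb_forall => /existsP[j]; rewrite negb_imply => /andP[jC].
  rewrite negb_imply => /andP[ij Bij].
  rewrite (bigD1 i) //= /row_mass (bigD1 j) //= /entry_mass (negbTE ij).
  by rewrite /planted_support iC !finset.inE (eq_sym j) ij jC mxE (negbTE Bij) !mul0r mulr0.
have den : \sum_(B | is_clique C B) A_rand R B = c.
  rewrite big_mkcond; transitivity (\sum_(B : 'M[bool]_n)
      c * \prod_i row_mass R i (planted_support C i) (row i B)).
    by apply: eq_bigr => B _; apply: num.
  rewrite -mulr_sumr.
  rewrite (sum_matrix_prod_row (fun i => row_mass R i (planted_support C i))).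
  by rewrite big1 ?mulr1 // => i _; apply: sum_row_mass.
rewrite /A_planted /conditioned num den.
by rewrite mulrAC mulfV // mul1r.
Qed.

(** After averaging over [C], double counting gives a sum over a sender [i] and a set of size [k.-1]
    avoiding it. The weights balance because [n * 'C(n.-1, k.-1) = k * 'C(n, k)]. *)
Lemma deterministic_clique_dist (R : realType) (n k : nat) (k0 : (0 < k)%N) (kn : (k < n)%N)
    (g : 'I_n -> 'rV[bool]_n -> bool) (acc : {ffun 'I_n -> bool} -> bool) :
  `|\sum_(A : 'M[bool]_n) (A_clique R k A - A_rand R A) * (acc [ffun i => g i (row i A)])%:R|
    <= 2 * k%:R ^+ 2 / Num.sqrt (n - k)%:R.
Proof.
pose N : R := 'C(n, k)%:R.
have N0 : 0 < N by rewrite ltr0n bin_gt0 ltnW.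
have cN : \sum_(C : {set 'I_n} | #|C| == k) 1 = N.
  rewrite sumr_const -cardsE /N -[in RHS](card_ord n) -card_draws; by [].
(* The normaliser of [A_clique] is written with a classical set, which has to be matched to the
   finite count. *)
have cN' : #|[set C : {set 'I_n} | #|C| == k]%classic|%:R = N.
  rewrite -cN sumr_const; congr (_%:R); apply: eq_card => C.
  by apply/idP/idP => [/set_mem|h]; [|apply/mem_set].
pose X C := \sum_(A : 'M[bool]_n) (A_planted R C A - A_rand R A)
  * (acc [ffun i => g i (row i A)])%:R.
have -> : \sum_(A : 'M[bool]_n) (A_clique R k A - A_rand R A)
    * (acc [ffun i => g i (row i A)])%:R = (\sum_(C : {set 'I_n} | #|C| == k) X C) / N.
  rewrite exchange_big /= mulr_suml; apply: eq_bigr => A _.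
  rewrite -mulr_suml mulrAC; congr (_ * _).
  rewrite sumrB mulrBl /A_clique cN'; congr (_ - _).
  under eq_bigr => C _ do rewrite -[A_rand R A]mul1r.
  by rewrite -mulr_suml cN mulrAC mulfV ?mul1r ?gt_eqF.
rewrite normrM normfV (gtr0_norm N0) ler_pdivrMr //.
apply: le_trans (ler_norm_sum _ _ _) _.
pose H i (S : {set 'I_n}) : R := `|row_mean R i (g i) S - row_mean R i (g i) finset.set0|.
apply: (@le_trans _ _ (\sum_(C : {set 'I_n} | #|C| == k) 2 * \sum_(i in C) H i (C :\ i)%SET)).
  apply: ler_sum => C _; rewrite /X.
  under eq_bigr => A _ do rewrite A_planted_row_mass A_rand_row_mass.
  apply: le_trans (deterministic_protocol_dist R g acc (planted_support C)) _.
  rewrite ler_pM2l // [leRHS]big_mkcond /=; apply: ler_sum => i _.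
  by rewrite /planted_support; case: ifP => // _; rewrite subrr normr0.
rewrite -mulr_sumr -(prednK k0) sum_card_succ_setD1.
rewrite -!mulrA ler_pM2l // prednK //.
apply: (@le_trans _ _ (\sum_(i < n) 'C(n.-1, k.-1)%:R * k.-1%:R / Num.sqrt (n - k)%:R)).
  by apply: ler_sum => i _; apply: sum_row_mean_dev; rewrite // prednK.
have binE : n%:R * 'C(n.-1, k.-1)%:R = k%:R * N.
  by rewrite -!natrM mul_bin_diag prednK.
rewrite sumr_const card_ord -[_ *+ n]mulr_natl !mulrA binE.
rewrite [leLHS](_ : _ = N * (k%:R / Num.sqrt (n - k)%:R) * k.-1%:R); last by ring.
rewrite [leRHS](_ : _ = N * (k%:R / Num.sqrt (n - k)%:R) * k%:R); last by ring.
rewrite ler_wpM2l ?ler_nat ?leq_pred //.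
by rewrite mulr_ge0 ?divr_ge0 ?ler0n ?sqrtr_ge0 // ltW.
Qed.

(** * Averaging over the private coins *)

Local Open Scope classical_set_scope.

Lemma fine_prob_preimage_fin (R : realType) (d : measure_display) (T : measurableType d)
    (P : probability T R) (F : finType) (X : T -> F)
    (mX : forall g, measurable [set w | X w = g]) (E : pred F) :
  fine (P [set w | E (X w)]) = \sum_(g | E g) fine (P [set w | X w = g]).
Proof.
have -> : [set w | E (X w)] = \bigcup_(g in [set` E]) [set w | X w = g].
  by apply/seteqP; split => [w Ew|w [g /= Eg ->]] //; exists (X w).
rewrite measure_fin_bigcup //=; last by move=> g1 g2 _ _ [w [/= <- <-]].
rewrite -(bigfs _ (index_enum_uniq F)) -?sum_fine // => g; last by rewrite mem_index_enum.
by move=> _; apply: fin_num_measure.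
Qed.

(** A randomised protocol is a mixture of deterministic ones, and the deterministic bound is
    uniform, so it survives averaging. *)
Lemma accept_prob_dist (R : realType) (n k : nat) (k0 : (0 < k)%N) (kn : (k < n)%N)
    (Pi : matrix_protocol R n 1) :
  `|accept_prob Pi (@A_clique R n k) - accept_prob Pi (@A_rand R n)|
    <= 2 * k%:R ^+ 2 / Num.sqrt (n - k)%:R.
Proof.
pose tape w i j := @coin _ _ (randomness Pi) i j w.
(* In one round every message is sent on the empty history, so the coins matter only through this
   table, which takes finitely many values. *)
pose table w : {ffun 'I_n -> {ffun 'rV[bool]_n -> bool}} :=
  [ffun i => [ffun x => message Pi i x (tape w i) [::]]].
pose P := coins_prob (randomness Pi).
have mtable g : measurable [set w | table w = g].
  have -> : [set w | table w = g] = \bigcap_(ix in [set: 'I_n * 'rV[bool]_n])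
      [set w | message Pi ix.1 ix.2 (tape w ix.1) [::] = g ix.1 ix.2].
    apply/seteqP; split => [w <- [i x] _ /=|w h]; first by rewrite !ffunE.
    by apply/ffunP => i; apply/ffunP => x; rewrite !ffunE (h (i, x)).
  apply: fin_bigcap_measurable => [|[i x] _]; first exact: finite_finset.
  have := @measurable_message _ _ _ _ Pi i x [::] measurableT [set g i x] I.
  by rewrite setTI.
pose accg (g : {ffun 'I_n -> {ffun 'rV[bool]_n -> bool}}) (A : 'M[bool]_n) :=
  accepting Pi [:: [ffun i => g i (row i A)]].
pose pr g : R := fine (P [set w | table w = g]).
have accE D : accept_prob Pi D = \sum_g pr g * \sum_A D A * (accg g A)%:R.
  under [RHS]eq_bigr => g _ do rewrite mulr_sumr.
  rewrite exchange_big /=; apply: eq_bigr => A _.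
  transitivity (D A * \sum_(g | accg g A) pr g).
    rewrite -(fine_prob_preimage_fin P mtable (accg^~ A)); congr (_ * fine (P _)).
    have trE w : transcript (fun i => row i A) w = [:: [ffun i => table w i (row i A)]].
      by congr [:: _]; apply/ffunP => i; rewrite !ffunE.
    by apply/seteqP; split => w /=; rewrite /accg trE.
  rewrite big_mkcond mulr_sumr; apply: eq_bigr => g _.
  by case: (accg g A); rewrite ?mulr1 ?mulr0 // mulrC.
rewrite !accE -sumrB.
apply: le_trans (ler_norm_sum _ _ _) _.
have pr1 : \sum_g pr g = 1.
  rewrite -(fine_prob_preimage_fin P mtable xpredT) -[RHS](congr1 fine (probability_setT P)).
  congr (fine (P _)); exact/seteqP.
set B := leRHS; have -> : B = \sum_g pr g * B by rewrite -mulr_suml pr1 mul1r.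
apply: ler_sum => g _.
have pr0 : 0 <= pr g by rewrite fine_ge0.
rewrite -mulrBr normrM (ger0_norm pr0); apply: ler_wpM2l => //.
rewrite -sumrB; under eq_bigr => A _ do rewrite -mulrBl.
exact: (deterministic_clique_dist R k0 kn (fun i => g i) (fun b => accepting Pi [:: b])).
Qed.

(** * Asymptotics for k = o(n^(1/4)) *)

Theorem corollary1p7 (R : realType) (k : nat -> nat)
  (k_gt0 : forall n, (0 < k n)%N)
  (k_small : (fun n => (k n)%:R : R^o) =o_\oo (fun n => n%:R `^ (4^-1) : R^o))
  (Pi : forall n, matrix_protocol R n 1) :
  accept_prob (Pi n) (@A_clique R n (k n)) - accept_prob (Pi n) (@A_rand R n)
    @[n --> \oo] --> (0 : R).
Proof.
apply/cvgrPdist_le => e e0.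
(* With x = n^(1/4) and k <= d x, the bound d <= 1/2 gives k <= n/2, hence sqrt (n - k) >= x^2 / 2.
   Both bounds on [d] together give d^2 <= e/4, so 2 k^2 <= e (x^2 / 2). *)
pose d : R := Num.min 2^-1 (e / 2).
have d0 : 0 < d by rewrite lt_min invr_gt0 ltr0n divr_gt0.
have d2 : d <= 2^-1 by rewrite ge_min lexx.
have de : d <= e / 2 by rewrite ge_min lexx orbT.
move/eqoP/(_ _ d0) : k_small => k_small.
near=> n.
have n1 : (1 <= n)%N by near: n; exists 1%N.
have : `|(k n)%:R : R^o| <= d * `|n%:R `^ 4^-1 : R^o| by near: n.
rewrite normr_nat ger0_norm ?powR_ge0 //; set x := n%:R `^ 4^-1 => kx.
have x4 : x ^+ 4 = n%:R by rewrite -powR_mulrn ?powR_ge0 // -powRrM mulVf ?powRr1.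
have x1 : 1 <= x.
  rewrite leNgt; apply/negP => xlt1.
  have := exprn_ilt1 4 (powR_ge0 _ _) xlt1; rewrite -/x x4 /=.
  by rewrite ltNge ler1n n1.
have x24 : x <= x ^+ 4 by apply: ler_eXnr.
have kn2 : (k n)%:R * 2 <= n%:R :> R.
  rewrite -x4; have := ler_wpM2r (le_trans ler01 x1) d2; lra.
have kn : (k n < n)%N.
  by have := k_gt0 n; rewrite -natrM ler_nat in kn2; lia.
have k2 : (k n)%:R ^+ 2 <= d ^+ 2 * x ^+ 2.
  by rewrite -exprMn lerXn2r ?nnegrE // mulr_ge0 ?(ltW d0) // (le_trans ler01).
have x20 : 0 < x ^+ 2 / 2 by rewrite divr_gt0 ?exprn_gt0 // (lt_le_trans ltr01).
have sq : x ^+ 2 / 2 <= Num.sqrt (n - k n)%:R.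
  rewrite -[leLHS](ger0_norm (ltW x20)) -sqrtr_sqr; apply: ler_wsqrtr.
  rewrite natrB ?(ltnW kn) // exprMn -exprM /= x4 exprVn; lra.
rewrite sub0r normrN; apply: le_trans (accept_prob_dist (k_gt0 n) kn (Pi n)) _.
rewrite ler_pdivrMr ?(lt_le_trans x20) //.
apply: le_trans (_ : e * (x ^+ 2 / 2) <= _); last by rewrite ler_pM2l.
have : d ^+ 2 * x ^+ 2 <= e / 4 * x ^+ 2.
  rewrite ler_wpM2r ?exprn_ge0 ?(le_trans ler01) //; nra.
lra.
Unshelve. all: by end_near.
Qed.
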